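(* Let $m,n\ge1$. The geometric energy function $D(\mathbf{x}_1,\dots,\mathbf{x}_m)=s^{(n)}_{(n-1)\delta_{m-1}}(\mathbf{x}_1,\dots,\mathbf{x}_m)$ has the product formula $$D(\mathbf{x}_1,\dots,\mathbf{x}_m)=\prod_{j=1}^{m-1}\ \sum_{X\subseteq[j+1,m-1]}\pi_j^{\,m-1-j-|X|}\,\Delta_{X\cup\{m\},\,\{j\}\cup X}(\overline{M}),$$ where $\pi_j=\overline{M}_{jj}$.
   Context: $[a,b]=\{k\in\mathbb{Z}:a\le k\le b\}$. The $x_i^j$ ($i\in[1,m]$, $j\in[1,n]$) are independent indeterminates over $\mathbb{C}$; for $r\in\mathbb{Z}$, $x_i^{(r)}=x_i^j$ where $j\in[1,n]$, $j\equiv r-i+1\pmod n$. $\mathbf{x}_i=(x_i^1,\dots,x_i^n)$ and $\mathbf{x}^j=(x_1^j,\dots,x_m^j)$. $(n-1)\delta_{m-1}$ is the partition $((n-1)(m-1),(n-1)(m-2),\dots,2(n-1),n-1)$. For a partition $\lambda$, the loop Schur function is $s^{(r)}_\lambda(\mathbf{x}_1,\dots,\mathbf{x}_m)=\sum_T\prod_{s\in\lambda}x_{T(s)}^{(c(s)+r)}$, the sum over semistandard Young tableaux $T$ of shape $\lambda$ with entries in $[1,m]$ (rows weakly increasing, columns strictly increasing; English notation), where the cell $s$ in row $a$ and column $b$ has $c(s)=a-b$. $W(y_1,\dots,y_m)$ is the $m\times m$ matrix with diagonal entries $y_1,\dots,y_m$, $1$'s in positions $(a+1,a)$, zeros elsewhere.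 $\overline{M}=W(\mathbf{x}^1)\cdots W(\mathbf{x}^n)$, so $\overline{M}_{jj}=x_j^1x_j^2\cdots x_j^n$. $\Delta_{A,B}(\overline{M})$ is the minor with rows $A$ and columns $B$ (in increasing order). *)

(* Defs.v *)
From mathcomp Require Import all_boot all_order all_algebra.

Set Implicit Arguments.
Unset Strict Implicit.
Unset Printing Implicit Defensive.

Import Order.TTheory GRing.Theory Num.Theory.
Local Open Scope ring_scope.

(* Indices are 1-based in the mathematics: the ordinal [i : 'I_m] stands for
   the index [i.+1].  The family [x_i^j] is stored as the matrix with entries
   [x i j]; its rows are the [x_i] and its columns the [x^j]. *)

(* The variable [x_i^(r)].  When [0 < n] exactly one [j] qualifies, so the value
   [0] is never used. *)
Definition loop_var (R : comNzRingType) (m n : nat) (x : 'M[R]_(m, n))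
    (i : 'I_m) (r : int) : R :=
  if [pick j : 'I_n | (j.+1%:Z == r - i.+1%:Z + 1 %[mod n%:Z])%Z] is Some j
  then x i j else 0.

(* Young diagrams in English notation; [nth 0 la a] is the length of row [a].
   Trailing zero parts contribute no cell. *)
Definition cell (la : seq nat) := {a : 'I_(size la) & 'I_(nth 0%N la a)}.

Definition cell_row (la : seq nat) (s : cell la) : nat := (tag s).+1.

Definition cell_col (la : seq nat) (s : cell la) : nat := (tagged s : 'I__).+1.

Definition content (la : seq nat) (s : cell la) : int :=
  (cell_row s)%:Z - (cell_col s)%:Z.

Definition semistandard (la : seq nat) (m : nat)
    (T : {ffun cell la -> 'I_m}) : bool :=
  [forall s : cell la, forall t : cell la,
    ((cell_row s == cell_row t) && (cell_col s < cell_col t)%N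
       ==> (T s <= T t)%N)
    && ((cell_col s == cell_col t) && (cell_row s < cell_row t)%N
       ==> (T s < T t)%N)].

Definition loop_schur (R : comNzRingType) (m n : nat) (x : 'M[R]_(m, n))
    (r : int) (la : seq nat) : R :=
  \sum_(T : {ffun cell la -> 'I_m} | semistandard T)
    \prod_(s : cell la) loop_var x (T s) (content s + r).

(* The partition [k * delta_(m-1) = (k(m-1), k(m-2), ..., k)]. *)
Definition scaled_staircase (k m : nat) : seq nat :=
  [seq (k * (m - a))%N | a <- iota 1 m.-1].

Definition geometric_energy (R : comNzRingType) (m n : nat)
    (x : 'M[R]_(m, n)) : R :=
  loop_schur x n%:Z (scaled_staircase n.-1 m).

Definition whirl (R : comNzRingType) (m : nat) (y : 'I_m -> R) : 'M[R]_m :=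
  \matrix_(a, b) (if a == b then y a else ((a : nat) == b.+1)%:R).

Definition Mbar (R : comNzRingType) (m n : nat) (x : 'M[R]_(m, n)) : 'M[R]_m :=
  \big[mulmx/1%:M]_(j < n) whirl (fun i => x i j).

(* [enum_val] lists a set of ordinals in increasing order.  The value is [0]
   when [A] and [B] have different sizes. *)
Definition minor (R : comNzRingType) (m : nat) (A B : {set 'I_m})
    (M : 'M[R]_m) : R :=
  if #|A| =P #|B| is ReflectT eqAB then
    \det (\matrix_(a < #|A|, b < #|A|)
            M (enum_val a) (enum_val (cast_ord eqAB b)))
  else 0.

(* Main.v *)
(** Let [M = Mbar x] and let [e_m] be the last basis row vector.  Subtracting
    multiples of consecutive rows, and expanding multilinearly, shows that the
    determinant with rows [e_m W(x^(r-l_i+1)) ... W(x^r)], where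
    [l_i = la_i + m - i], obeys the branching rule of the loop Schur function
    [s_la^(r)] (remove all the entries [m] of the tableau); hence they are
    equal.  For the staircase [(n-1) delta_(m-1)] and [r = n] one has
    [l_i = n (m - i)], so by periodicity row [i] is [e_m M^(m-i)] and the
    geometric energy is a Krylov determinant of the lower triangular matrix [M].
    Subtracting [pi_1] times row [i+1] from row [i] replaces [e_m M^(m-i)] by
    [e_m M^(m-i-1) (M - pi_1)]; since the first row of [M - pi_1] vanishes, the
    corner minor [Delta_([2,m],[1,m-1]) (M - pi_1)] splits off and leaves the
    Krylov determinant of [M] with its first row and column removed.  Finally
    the [j]-th corner minor is expanded in powers of [pi_j]. *)
Require Import Defs.
From mathcomp Require Import all_boot all_order all_algebra.
From mathcomp Require Import zify.
From mathcomp Require Import reals.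
From mathcomp Require Import complex.
From mathcomp Require Import mpoly.

Set Implicit Arguments.
Unset Strict Implicit.
Unset Printing Implicit Defensive.

Import Order.TTheory GRing.Theory Num.Theory.
Local Open Scope ring_scope.

(** * Determinants of path sums *)

(** Left multiplication by the unipotent upper bidiagonal matrix with entries [- w i] above the
    diagonal. All rows change at once, so multiples of the original rows are subtracted. *)
Lemma det_sub_next (R : comNzRingType) (n : nat) (A : nat -> nat -> R)
    (w : nat -> R) :
  \det (\matrix_(i < n.+1, c < n.+1) A i c) =
  \det (\matrix_(i < n.+1, c < n.+1)
          (A i c - (if (i < n)%N then w i * A i.+1 c else 0))).
Proof.
pose U : 'M[R]_n.+1 := \matrix_(i, k)
  ((i == k)%:R - (if k == i.+1 :> nat then w i else 0)).
have detU : \det U = 1.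
  rewrite -det_tr det_trig; last first.
    apply/is_trig_mxP => i k ik; rewrite !mxE.
    by rewrite ltn_eqF ?(leqW ik) // subr0 -val_eqE gtn_eqF.
  by rewrite big1 // => i _; rewrite !mxE eqxx ltn_eqF ?subr0.
rewrite -[LHS]mul1r -detU -det_mulmx; congr (\det _).
apply/matrixP => i c; rewrite !mxE.
under eq_bigr do rewrite !mxE mulrBl.
rewrite sumrB; congr (_ - _).
  rewrite (bigD1 i) //= eqxx mul1r big1 ?addr0 // => k.
  by rewrite eq_sym => /negPf->; rewrite mul0r.
case: ifP => i_lt.
  rewrite (bigD1 (Ordinal (i_lt : (i.+1 < n.+1)%N))) //= eqxx big1 ?addr0 // => k.
  by rewrite -val_eqE /= => /negPf->; rewrite mul0r.
rewrite big1 // => k _; case: eqP => [ki|_]; last by rewrite mul0r.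
by move: (ltn_ord k); rewrite ki ltnS i_lt.
Qed.

Lemma det_last_row (R : comNzRingType) (n : nat) (A : nat -> nat -> R) :
  (forall c, (c < n)%N -> A n c = 0) ->
  \det (\matrix_(i < n.+1, c < n.+1) A i c) =
  A n n * \det (\matrix_(i < n, c < n) A i c).
Proof.
move=> A0; rewrite (expand_det_row _ ord_max) big_ord_recr /= big1 ?add0r.
  rewrite mxE /cofactor /= -signr_odd addnn odd_double expr0 mul1r.
  congr (_ * \det _); apply/matrixP => i c; rewrite !mxE /= /bump.
  by rewrite !(leqNgt n) !ltn_ord.
by move=> c _; rewrite mxE /= A0 ?mul0r.
Qed.

Lemma det_last_col (R : comNzRingType) (n : nat) (A : nat -> nat -> R) :
  (forall i, (i < n)%N -> A i n = 0) ->
  \det (\matrix_(i < n.+1, c < n.+1) A i c) =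
  A n n * \det (\matrix_(i < n, c < n) A i c).
Proof.
move=> A0.
have trA k : \det (\matrix_(i < k, c < k) A i c) =
             \det (\matrix_(i < k, c < k) A c i).
  by rewrite -det_tr; congr (\det _); apply/matrixP => i c; rewrite !mxE.
by rewrite !trA (det_last_row (A := fun i c => A c i)).
Qed.

(** Multilinearity in all rows at once: in the Leibniz formula the product of the row sums is
    expanded over the choices [f] of one summand per row. *)
Lemma det_sum_rows (R : comNzRingType) (n : nat) (I : finType)
    (a : 'I_n -> I -> R) (B : 'I_n -> I -> 'I_n -> R) :
  \det (\matrix_(i, c) \sum_q a i q * B i q c) =
  \sum_(f : {ffun 'I_n -> I})
    (\prod_i a i (f i)) * \det (\matrix_(i, c) B i (f i) c).
Proof.
rewrite /determinant.
under eq_bigr => s _.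
  under eq_bigr do rewrite mxE.
  rewrite bigA_distr_bigA mulr_sumr.
  under eq_bigr do rewrite big_split mulrCA.
  over.
rewrite exchange_big; apply: eq_bigr => f _ /=.
rewrite mulr_sumr; apply: eq_bigr => s _; congr (_ * (_ * _)).
by apply: eq_bigr => i _; rewrite mxE.
Qed.

(* The [(a, c)] entry of the product [W_(l-1) ... W_0], where [W_s] is the whirl
   matrix with diagonal [y _ s]. *)
Fixpoint path_sum (R : comNzRingType) (y : nat -> nat -> R) (l a c : nat) : R :=
  if l is l'.+1 then
    y a l' * path_sum y l' a c + (if a is a'.+1 then path_sum y l' a' c else 0)
  else (a == c)%:R.

Lemma path_sum_gt (R : comNzRingType) (y : nat -> nat -> R) (l a c : nat) :
  (a < c)%N -> path_sum y l a c = 0.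
Proof.
elim: l a => [|l IHl] a ac /=; first by rewrite ltn_eqF.
rewrite IHl // mulr0 add0r; case: a ac => // a ac; apply: IHl; lia.
Qed.

Lemma path_sum_diag (R : comNzRingType) (y : nat -> nat -> R) (l a : nat) :
  path_sum y l a a = \prod_(0 <= s < l) y a s.
Proof.
elim: l => [|l IHl] /=; first by rewrite big_geq ?eqxx.
rewrite big_nat_recr //= -IHl mulrC; case: a {IHl} => [|a]; rewrite ?addr0 //.
by rewrite (path_sum_gt _ _ (ltnSn a)) addr0.
Qed.

(** A path from level [a] reads the times downwards from [p - 1]. Either it stays at level [a]
    through all times down to [q], or it first drops to [a - 1] at some time [k] with
    [q <= k < p]. *)
Lemma path_sum_split (R : comNzRingType) (y : nat -> nat -> R) (p q a c : nat) :
  (0 < a)%N -> (q <= p)%N ->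
  path_sum y p a c =
  (\prod_(q <= s < p) y a s) * path_sum y q a c +
  \sum_(q <= k < p) (\prod_(k.+1 <= s < p) y a s) * path_sum y k a.-1 c.
Proof.
case: a => // a _; elim: p => [|p IHp] qp.
  by move: qp; rewrite leqn0 => /eqP ->; rewrite !big_geq // mul1r addr0.
have [->|qp'] := eqVneq q p.+1; first by rewrite !big_geq // mul1r addr0.
have {}qp : (q <= p)%N by lia.
rewrite /= IHp // (big_nat_recr p q) //= [in RHS](big_nat_recr p q) //=.
rewrite [\prod_(p.+1 <= _ < _) _]big_geq // mul1r.
rewrite mulrDr addrA; congr (_ + _ + _); first by rewrite mulrCA mulrA.
rewrite mulr_sumr; apply: eq_big_nat => k /andP[_ kp].
by rewrite big_nat_recr //= mulrA [y _ _ * _]mulrC.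
Qed.

(** Extension by zero: row [k] of a shape with [k] rows exists and is empty, as the branching rule
    requires. *)
Definition row_length (k N : nat) (nu : {ffun 'I_k -> 'I_N}) (i : nat) : nat :=
  if insub i is Some j then nu j else 0%N.

Lemma row_length_ord (k N : nat) (nu : {ffun 'I_k -> 'I_N}) (i : 'I_k) :
  row_length nu i = nu i.
Proof. by rewrite /row_length valK. Qed.

Lemma row_length_out (k N : nat) (nu : {ffun 'I_k -> 'I_N}) (i : nat) :
  (k <= i)%N -> row_length nu i = 0%N.
Proof. by move=> ki; rewrite /row_length insubN // -leqNgt. Qed.

(* The loop Schur function of shape [mu] in [k] rows of variables; row [i] is the
   last row of a product of [mu_i + k - i] whirl matrices ([i] is 0-based here,
   whence the [k.-1]). *)
Definition schur_det (R : comNzRingType) (y : nat -> nat -> R) (k : nat)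
    (mu : nat -> nat) : R :=
  \det (\matrix_(i < k, c < k) path_sum y (mu i + (k.-1 - i)) k.-1 c).

(** Once the row operation has cleared the last column above the corner, row [i < k] is a sum over
    the time [q] at which a path leaves level [k]. Writing [q] as [nu i + (k.-1 - i)] turns the
    range of [q] into [mu i.+1 <= nu i <= mu i], so a choice of summands is a shape [nu] with
    [mu / nu] a horizontal strip, and the determinant left is that of [nu]. *)
Lemma schur_det_branching (R : comNzRingType) (y : nat -> nat -> R)
    (k N : nat) (mu : nat -> nat) :
  (forall i, mu i.+1 <= mu i)%N -> (mu 0%N < N)%N ->
  schur_det y k.+1 mu =
  \sum_(nu : {ffun 'I_k -> 'I_N} | [forall i : 'I_k, mu i.+1 <= nu i <= mu i]%N)
    (\prod_(i < k.+1)
       \prod_(row_length nu i <= b < mu i) y k (b + k - i)%N) *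
    schur_det y k (row_length nu).
Proof.
move=> mu_dec mu0N.
have muN i : (mu i < N)%N.
  by elim: i => // i; apply: leq_ltn_trans (mu_dec i).
pose l i := (mu i + (k - i))%N.
have lS i : (i < k)%N -> (l i.+1 <= l i)%N.
  by move=> ik; rewrite /l leq_add // leq_sub2l.
(* The multiple is chosen so that, in [path_sum_split], only the paths leaving
   level [k] between times [l i.+1] and [l i] survive. *)
rewrite /schur_det /= (det_sub_next _ (fun i c => path_sum y (l i) k c)
  (fun i => \prod_(l i.+1 <= s < l i) y k s)).
pose B i c := \sum_(l i.+1 <= q < l i)
  (\prod_(q.+1 <= s < l i) y k s) * path_sum y q k.-1 c.
have subE i c : (i < k)%N -> path_sum y (l i) k c -
    (\prod_(l i.+1 <= s < l i) y k s) * path_sum y (l i.+1) k c = B i c.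
  move=> ik; rewrite (@path_sum_split _ _ (l i) (l i.+1)) ?lS //; last by lia.
  by rewrite addrC addKr.
rewrite (det_last_col (A := fun i c => path_sum y (l i) k c -
  (if (i < k)%N then (\prod_(l i.+1 <= s < l i) y k s) *
     path_sum y (l i.+1) k c else 0))); last first.
  move=> i ik; rewrite ik subE // /B big1 // => q _.
  by rewrite path_sum_gt ?mulr0 //; lia.
(* The corner entry is the product over the times below [mu k]: row [k] of [mu] is filled entirely
   with the entry [k]. *)
rewrite ltnn subr0 path_sum_diag /l subnn addn0.
(* The value [0] lets [q] range over ['I_N] in every row: choices that do not interlace drop out. *)
pose a (i : 'I_k) (q : 'I_N) : R := if (mu i.+1 <= q <= mu i)%N then
  \prod_(q <= b < mu i) y k (b + k - i)%N else 0.
have -> : \det (\matrix_(i < k, c < k) (path_sum y (l i) k c -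
    (if (i < k)%N then (\prod_(l i.+1 <= s < l i) y k s) *
       path_sum y (l i.+1) k c else 0))) =
  \det (\matrix_(i < k, c < k) \sum_q a i q *
      path_sum y (q + (k.-1 - i)) k.-1 c).
  congr (\det _); apply/matrixP => i c; rewrite !mxE ltn_ord subE //.
  have ik := ltn_ord i.
  have -> : B i c = \sum_(mu i.+1 + (k.-1 - i) <= q < (mu i).+1 + (k.-1 - i))
      (\prod_(q.+1 <= s < l i) y k s) * path_sum y q k.-1 c.
    by rewrite /B /l; congr (bigop _ (index_iota _ _) _); lia.
  rewrite big_addn addnK big_geq_mkord.
  rewrite (big_ord_widen_cond N (fun q => mu i.+1 <= q)%N (fun q =>
    (\prod_((q + (k.-1 - i)).+1 <= s < l i) y k s) *
      path_sum y (q + (k.-1 - i)) k.-1 c)) // big_mkcond /=.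
  apply: eq_bigr => q _; rewrite /a ltnS.
  case: ifP => _; last by rewrite mul0r.
  have -> : (q + (k.-1 - i)).+1 = (q + (k - i))%N by lia.
  rewrite big_addn /l addnK; congr (_ * _).
  by apply: eq_bigr => b _; congr y; lia.
rewrite (det_sum_rows a (fun i q c => path_sum y (q + (k.-1 - i)) k.-1 c)).
rewrite mulr_sumr [RHS]big_mkcond /=; apply: eq_bigr => nu _.
case: ifP => [/forallP muP|/negbT/forallPn[i nuP]]; last first.
  by rewrite (bigD1 i) //= /a (negPf nuP) !mul0r mulr0.
rewrite mulrA; congr (_ * _); last first.
  by congr (\det _); apply/matrixP => i c; rewrite !mxE row_length_ord.
rewrite big_ord_recr /= row_length_out // mulrC; congr (_ * _).
  by apply: eq_bigr => i _; rewrite /a muP row_length_ord.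
by apply: eq_bigr => b _; rewrite addnK.
Qed.

(** * Branching of tableaux *)

Definition crow (la : seq nat) (s : cell la) : nat := tag s.
Definition ccol (la : seq nat) (s : cell la) : nat := (tagged s : 'I__).

Lemma cell_inj (la : seq nat) (s t : cell la) :
  crow s = crow t -> ccol s = ccol t -> s = t.
Proof.
case: s t => [a b] [a' b']; rewrite /crow /ccol /= => /val_inj aa'.
by case: a' / aa' b' => b' /val_inj ->.
Qed.

Lemma ccol_lt (la : seq nat) (s : cell la) : (ccol s < nth 0%N la (crow s))%N.
Proof. exact: ltn_ord. Qed.

Lemma exists_cell (la : seq nat) (i b : nat) :
  (b < nth 0%N la i)%N -> exists s : cell la, crow s = i /\ ccol s = b.
Proof.
move=> bi; have [i_lt|i_ge] := ltnP i (size la); last first.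
  by move: bi; rewrite nth_default.
by exists (Tagged (fun a : 'I_(size la) => 'I_(nth 0%N la a))
             (Ordinal bi : 'I_(nth 0%N la (Ordinal i_lt)))).
Qed.

Lemma prod_cells (R : comNzRingType) (la : seq nat) (p : nat)
    (nu mu : nat -> nat) (F : nat -> nat -> R) :
  (forall i, mu i <= nth 0%N la i)%N -> (forall i, p <= i -> mu i = 0)%N ->
  \prod_(s : cell la | (nu (crow s) <= ccol s < mu (crow s))%N)
    F (crow s) (ccol s) =
  \prod_(i < p) \prod_(nu i <= b < mu i) F i b.
Proof.
move=> mula mu0; pose G i := \prod_(nu i <= b < mu i) F i b.
have G1 i : mu i = 0%N -> G i = 1 by move=> mui; rewrite /G mui big_geq.
transitivity (\prod_(a < size la) G a).
  rewrite -(sig_big_dep (J := fun a : 'I_(size la) => 'I_(nth 0%N la a)) predT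
    (fun a b => nu a <= b < mu a)%N (fun a b => F a b)) /=.
  apply: eq_bigr => a _; rewrite /G big_geq_mkord.
  rewrite (big_ord_widen_cond (nth 0%N la a) (fun b => nu a <= b)%N (F a)) //.
have prodG q r : (q <= r)%N -> (forall i, q <= i -> mu i = 0)%N ->
    \prod_(a < q) G a = \prod_(a < r) G a.
  move=> qr mu0'; rewrite (big_ord_widen r G qr) big_mkcond /=.
  by apply: eq_bigr => a _; case: ltnP => // /mu0' /G1 ->.
have mu0' i : (size la <= i)%N -> mu i = 0%N.
  by move=> i_ge; have := mula i; rewrite nth_default // leqn0 => /eqP.
by case/orP: (leq_total p (size la)) => /prodG ->.
Qed.

Lemma card_row_prefix (la : seq nat) (i n : nat) (S : {set cell la}) :
  (n <= nth 0%N la i)%N ->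
  (forall s, (s \in S) = (crow s == i) && (ccol s < n)%N) -> #|S| = n.
Proof.
move=> nla SP; rewrite -[RHS](size_iota 0) cardE -(size_map (@ccol la)).
apply/perm_size/uniq_perm; rewrite ?iota_uniq //.
  rewrite map_inj_in_uniq ?enum_uniq // => s t.
  rewrite !mem_enum !SP => /andP[/eqP si _] /andP[/eqP ti _].
  by apply: cell_inj; rewrite si ti.
move=> b; rewrite mem_iota add0n /=; apply/mapP/idP => [[s]|bn].
  by rewrite mem_enum SP => /andP[_ sn] ->.
have [s [si sb]] := exists_cell (leq_trans bn nla).
by exists s; rewrite // mem_enum SP si sb eqxx.
Qed.

(** If [s] is in [S], so is every cell to its left, whence [ccol s < #|S|]; if not, all of [S] lies
    strictly to its left. A left-justified part of a row is thus recorded by its cardinality. *)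
Lemma row_prefix_card (la : seq nat) (i : nat) (S : {set cell la}) :
  (forall s, s \in S -> crow s = i) ->
  (forall s t, s \in S -> crow t = i -> (ccol t < ccol s)%N -> t \in S) ->
  forall s, crow s = i -> (s \in S) = (ccol s < #|S|)%N.
Proof.
move=> Si Sdown s si; rewrite cardE -(size_map (@ccol la)).
have cols_uniq : uniq [seq ccol t | t <- enum S].
  rewrite map_inj_in_uniq ?enum_uniq // => t u.
  rewrite !mem_enum => /Si ti /Si ui.
  by apply: cell_inj; rewrite ti ui.
apply/idP/idP => [sS|].
  rewrite -(size_iota 0 (ccol s).+1); apply: uniq_leq_size.
    exact: iota_uniq.
  move=> b; rewrite mem_iota add0n /= ltnS leq_eqVlt => bs.
  have /exists_cell[t [ti tb]] : (b < nth 0%N la i)%N.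
    have := ccol_lt s; rewrite si.
    by case/orP: bs => [/eqP ->|/ltn_trans] //; apply.
  apply/mapP; exists t => //; rewrite mem_enum; case/orP: bs => [/eqP bs|bs].
    by have -> : t = s by apply: cell_inj; rewrite ?ti ?tb.
  by apply: Sdown sS ti _; rewrite tb.
apply: contraTT => sS; rewrite -leqNgt -[leqRHS](size_iota 0).
apply: uniq_leq_size => // b /mapP[t]; rewrite mem_enum => tS ->.
rewrite mem_iota add0n /= ltnNge leq_eqVlt; apply/negP => /orP[/eqP st|st].
  have ts : t = s by apply: cell_inj; rewrite ?(Si t tS).
  by rewrite ts (negPf sS) in tS.
by move: sS; rewrite (Sdown t s tS si st).
Qed.

Definition in_shape (la : seq nat) (mu : nat -> nat) (s : cell la) : bool :=
  (ccol s < mu (crow s))%N.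

(* Tableaux of shape [mu] with entries below [k], stored on the cells of the
   larger diagram [la]: the cells outside [mu] carry the dummy value [ord0]. *)
Definition partial_tableau (la : seq nat) (m k : nat) (mu : nat -> nat)
    (T : {ffun cell la -> 'I_m.+1}) : bool :=
  [forall s, if in_shape mu s then (T s < k)%N else T s == ord0] &&
  [forall s, forall t, in_shape mu s && in_shape mu t ==>
    ((crow s == crow t) && (ccol s < ccol t)%N ==> (T s <= T t)%N) &&
    ((ccol s == ccol t) && (crow s < crow t)%N ==> (T s < T t)%N)].

Lemma partial_tableauP (la : seq nat) (m k : nat) (mu : nat -> nat)
    (T : {ffun cell la -> 'I_m.+1}) :
  reflect
    [/\ forall s, in_shape mu s -> (T s < k)%N,
        forall s, ~~ in_shape mu s -> T s = ord0,
        forall s t, in_shape mu s -> in_shape mu t ->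
          crow s = crow t -> (ccol s < ccol t)%N -> (T s <= T t)%N &
        forall s t, in_shape mu s -> in_shape mu t ->
          ccol s = ccol t -> (crow s < crow t)%N -> (T s < T t)%N]
    (partial_tableau k mu T).
Proof.
apply: (iffP andP) => [[/forallP Tk /forallP Tlt]|[Tk T0 Trow Tcol]]; split.
- by move=> s sm; have := Tk s; rewrite sm.
- by move=> s /negPf sm; have := Tk s; rewrite sm => /eqP.
- move=> s t sm tm rst cst; have /forallP/(_ t) := Tlt s.
  by rewrite sm tm rst cst eqxx /= => /andP[].
- move=> s t sm tm cst rst; have /forallP/(_ t) := Tlt s.
  by rewrite sm tm rst cst eqxx /= => /andP[].
- by apply/forallP => s; case: ifP => [/Tk //|/negbT /T0 ->].
- apply/forallP => s; apply/forallP => t; apply/implyP => /andP[sm tm].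
  apply/andP; split; apply/implyP => /andP[/eqP ? ?]; first exact: Trow.
  exact: Tcol.
Qed.

Definition tableau_sum (R : comNzRingType) (la : seq nat) (m : nat)
    (wt : nat -> cell la -> R) (k : nat) (mu : nat -> nat) : R :=
  \sum_(T : {ffun cell la -> 'I_m.+1} | partial_tableau k mu T)
    \prod_(s | in_shape mu s) wt (T s) s.

(** Columns increase strictly from row [0] on. Hence entries below [k] occur only in the first [k]
    rows, which is why [shape_below] has [k] rows. *)
Lemma tableau_ge_row (la : seq nat) (m k : nat) (mu : nat -> nat)
    (T : {ffun cell la -> 'I_m.+1}) :
  (forall i, mu i.+1 <= mu i)%N -> (forall i, mu i <= nth 0%N la i)%N ->
  partial_tableau k mu T -> forall s, in_shape mu s -> (crow s <= T s)%N.
Proof.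
move=> mu_dec mula /partial_tableauP[_ _ _ Tcol] s.
move: {2}(crow s) (erefl (crow s)) => i; elim: i s => [|i IHi] s si sm.
  by rewrite si.
have cs : (ccol s < mu i)%N by apply: leq_trans (mu_dec i); rewrite -si.
have [t [ti ts]] := exists_cell (leq_trans cs (mula i)).
have tm : in_shape mu t by rewrite /in_shape ti ts.
have := IHi t ti tm; rewrite si ti => it; apply: leq_ltn_trans it _.
by apply: Tcol; rewrite ?ti ?si.
Qed.

Definition row_below (la : seq nat) (m k : nat) (mu : nat -> nat)
    (T : {ffun cell la -> 'I_m.+1}) (i : nat) : {set cell la} :=
  [set s | [&& crow s == i, in_shape mu s & (T s < k)%N]].

Definition shape_below (la : seq nat) (m k N : nat) (mu : nat -> nat)
    (T : {ffun cell la -> 'I_m.+1}) : {ffun 'I_k -> 'I_N.+1} :=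
  [ffun i : 'I_k => inord #|row_below k mu T i|].

Lemma card_row_below (la : seq nat) (m k : nat) (mu : nat -> nat)
    (T : {ffun cell la -> 'I_m.+1}) (i : nat) :
  (forall i, mu i <= nth 0%N la i)%N -> (#|row_below k mu T i| <= mu i)%N.
Proof.
move=> mula.
pose S : {set cell la} := [set s | (crow s == i) && (ccol s < mu i)%N].
rewrite -[leqRHS](@card_row_prefix la i (mu i) S) //; last first.
  by move=> s; rewrite inE.
apply/subset_leq_card/subsetP => s; rewrite !inE => /and3P[/eqP si].
by rewrite /in_shape si eqxx => ->.
Qed.

Lemma row_length_shape_below (la : seq nat) (m k N : nat) (mu : nat -> nat)
    (T : {ffun cell la -> 'I_m.+1}) (i : nat) :
  (forall i, mu i <= nth 0%N la i)%N -> (mu i <= N)%N -> (i < k)%N ->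
  row_length (shape_below k N mu T) i = #|row_below k mu T i|.
Proof.
move=> mula muN ik; rewrite (row_length_ord _ (Ordinal ik)) ffunE inordK // ltnS.
exact: leq_trans (card_row_below _ _ _ _) muN.
Qed.

Lemma mem_row_below (la : seq nat) (m k : nat) (mu : nat -> nat)
    (T : {ffun cell la -> 'I_m.+1}) :
  (forall i, mu i <= nth 0%N la i)%N -> partial_tableau k.+1 mu T ->
  forall s, in_shape mu s ->
    (T s < k)%N = (ccol s < #|row_below k mu T (crow s)|)%N.
Proof.
move=> mula /partial_tableauP[_ _ Trow _] s sm.
rewrite -(@row_prefix_card _ (crow s) (row_below k mu T (crow s))) //.
- by rewrite inE eqxx sm.
- by move=> t; rewrite inE => /andP[/eqP].
move=> t u; rewrite !inE => /and3P[/eqP ti tm Tt] ui ut.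
have um : in_shape mu u by rewrite /in_shape ui -ti; apply: ltn_trans ut _.
by rewrite ui eqxx um /=; apply: leq_ltn_trans Tt; apply: Trow; rewrite ?ti ?ui.
Qed.

Lemma in_shape_below (la : seq nat) (m k N : nat) (mu : nat -> nat)
    (T : {ffun cell la -> 'I_m.+1}) :
  (forall i, mu i.+1 <= mu i)%N -> (forall i, mu i <= nth 0%N la i)%N ->
  (mu 0%N <= N)%N -> partial_tableau k.+1 mu T ->
  forall s, in_shape mu s ->
    (T s < k)%N = in_shape (row_length (shape_below k N mu T)) s.
Proof.
move=> mu_dec mula mu0N Ttab s sm; rewrite /in_shape.
have muN i : (mu i <= N)%N by elim: i => // i; apply: leq_trans (mu_dec i).
have [ks|sk] := leqP k (crow s).
  rewrite row_length_out // ltn0; apply/negbTE; rewrite -leqNgt.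
  exact: leq_trans ks (tableau_ge_row mu_dec mula Ttab sm).
by rewrite row_length_shape_below // -mem_row_below.
Qed.

(** The last cell of row [i.+1] has entry at most [k], so the cell above it has entry below [k], and
    row [i] has at least [mu i.+1] such entries. *)
Lemma shape_below_interlace (la : seq nat) (m k N : nat) (mu : nat -> nat)
    (T : {ffun cell la -> 'I_m.+1}) :
  (forall i, mu i.+1 <= mu i)%N -> (forall i, mu i <= nth 0%N la i)%N ->
  (mu 0%N <= N)%N -> partial_tableau k.+1 mu T ->
  [forall i : 'I_k, mu i.+1 <= shape_below k N mu T i <= mu i]%N.
Proof.
move=> mu_dec mula mu0N Ttab; apply/forallP => i.
have muN j : (mu j <= N)%N by elim: j => // j; apply: leq_trans (mu_dec j).
rewrite -row_length_ord row_length_shape_below // card_row_below // andbT.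
case mui: (mu i.+1) => [//|b].
have bi : (b < mu i)%N by rewrite -mui.
have bi1 : (b < mu i.+1)%N by rewrite mui.
have [s [si sb]] := exists_cell (leq_trans bi (mula i)).
have [t [ti tb]] := exists_cell (leq_trans bi1 (mula i.+1)).
have sm : in_shape mu s by rewrite /in_shape si sb.
have tm : in_shape mu t by rewrite /in_shape ti tb.
have [Tk _ _ Tcol] := partial_tableauP _ _ _ Ttab.
rewrite -sb -si -mem_row_below // -ltnS.
apply: leq_trans (Tk t tm); rewrite ltnS.
by apply: Tcol; rewrite ?sb ?tb // si ti.
Qed.

Definition extend_tableau (la : seq nat) (m k : nat) (nu mu : nat -> nat)
    (T : {ffun cell la -> 'I_m.+1}) : {ffun cell la -> 'I_m.+1} :=
  [ffun s => if in_shape nu s then T s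
             else if in_shape mu s then inord k else ord0].

Definition restrict_tableau (la : seq nat) (m : nat) (nu : nat -> nat)
    (T : {ffun cell la -> 'I_m.+1}) : {ffun cell la -> 'I_m.+1} :=
  [ffun s => if in_shape nu s then T s else ord0].

(** The left side is the condition produced by reindexing the tableaux of shape [mu] that lie over
    [nu]. By interlacing no two cells of [mu / nu] share a column, so filling them with [k] keeps
    the columns strict; they end their rows, so the rows stay weakly increasing. *)
Lemma extend_tableauP (la : seq nat) (m k N : nat) (mu : nat -> nat)
    (nu : {ffun 'I_k -> 'I_N.+1}) (T : {ffun cell la -> 'I_m.+1}) :
  (k <= m)%N -> (forall i, mu i.+1 <= mu i)%N ->
  (forall i, mu i <= nth 0%N la i)%N ->
  (forall i, k < i -> mu i = 0)%N -> (mu 0%N <= N)%N ->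
  [forall i : 'I_k, mu i.+1 <= nu i <= mu i]%N ->
  let T' := extend_tableau k (row_length nu) mu T in
  (partial_tableau k.+1 mu T' && (shape_below k N mu T' == nu)) &&
    (restrict_tableau (row_length nu) T' == T) =
  partial_tableau k (row_length nu) T.
Proof.
move=> km mu_dec mula mu0 mu0N /forallP munu T'.
have muN j : (mu j <= N)%N by elim: j => // j; apply: leq_trans (mu_dec j).
have mu_anti i j : (i <= j)%N -> (mu j <= mu i)%N.
  by elim: j => [|j IHj]; rewrite leq_eqVlt => /orP[/eqP -> //|//] /IHj;
    apply: leq_trans.
have nu_mu i : (row_length nu i <= mu i)%N.
  have [ik|ki] := ltnP i k; last by rewrite row_length_out.
  by rewrite (row_length_ord nu (Ordinal ik)); case/andP: (munu (Ordinal ik)).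
have mu_nu i : (mu i.+1 <= row_length nu i)%N.
  have [ik|ki] := ltnP i k; last by rewrite mu0.
  by rewrite (row_length_ord nu (Ordinal ik)); case/andP: (munu (Ordinal ik)).
have sub (s : cell la) : in_shape (row_length nu) s -> in_shape mu s.
  by move=> snu; apply: leq_trans (nu_mu _).
have above (s t : cell la) : ccol s = ccol t -> (crow s < crow t)%N ->
    in_shape mu t -> in_shape (row_length nu) s.
  rewrite /in_shape => -> st tm; apply: leq_trans (mu_nu _).
  by apply: leq_trans tm _; apply: mu_anti.
have left (s t : cell la) : crow s = crow t -> (ccol s < ccol t)%N ->
    in_shape (row_length nu) t -> in_shape (row_length nu) s.
  by rewrite /in_shape => -> /ltn_trans; apply.
have T'in s : in_shape (row_length nu) s -> T' s = T s.
  by rewrite /T' ffunE => ->.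
have T'k s : in_shape mu s -> ~~ in_shape (row_length nu) s -> T' s = k :> nat.
  by rewrite /T' ffunE => -> /negPf ->; rewrite inordK.
apply/idP/idP => [/andP[/andP[T'tab /eqP T'nu] /eqP resT']|Ttab].
  have [_ _ Trow Tcol] := partial_tableauP _ _ _ T'tab.
  apply/partial_tableauP; split.
  - move=> s snu; rewrite -T'in //.
    rewrite (in_shape_below (N := N) mu_dec mula mu0N T'tab) ?sub //.
    by rewrite T'nu.
  - by move=> s snu; rewrite -resT' ffunE (negPf snu).
  - by move=> s t snu tnu; rewrite -!T'in //; apply: Trow; apply: sub.
  - by move=> s t snu tnu; rewrite -!T'in //; apply: Tcol; apply: sub.
have [Tk T0 Trow Tcol] := partial_tableauP _ _ _ Ttab.
apply/andP; split; last first.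
  apply/eqP/ffunP => s; rewrite ffunE; case: ifP => [/T'in //|/negbT /T0 ->] //.
have T'tab : partial_tableau k.+1 mu T'.
  apply/partial_tableauP; split.
  - move=> s sm; case: (boolP (in_shape (row_length nu) s)) => snu.
      by rewrite T'in // ltnW // ltnS Tk.
    by rewrite T'k.
  - move=> s sm; rewrite /T' ffunE (negPf sm) ifN //.
    by apply: contraNN sm; apply: sub.
  - move=> s t sm tm st cst.
    case: (boolP (in_shape (row_length nu) t)) => tnu.
      by have snu := left s t st cst tnu; rewrite !T'in //; apply: Trow.
    rewrite (T'k t) //; case: (boolP (in_shape (row_length nu) s)) => snu.
      by rewrite T'in // ltnW // Tk.
    by rewrite T'k.
  - move=> s t sm tm cst st; have snu := above s t cst st tm.
    case: (boolP (in_shape (row_length nu) t)) => tnu.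
      by rewrite !T'in //; apply: Tcol.
    by rewrite (T'k t) // T'in // Tk.
rewrite T'tab; apply/eqP/ffunP => i; apply: val_inj => /=.
rewrite -row_length_ord row_length_shape_below //.
apply: card_row_prefix; first by apply: leq_trans (mula i); case/andP: (munu i).
move=> s; rewrite inE; case: eqP => //= si.
have nuE : (ccol s < nu i)%N = in_shape (row_length nu) s.
  by rewrite /in_shape si row_length_ord.
rewrite nuE; case: (boolP (in_shape (row_length nu) s)) => snu.
  by rewrite sub // T'in ?Tk.
by case: (boolP (in_shape mu s)) => //= sm; rewrite T'k // ltnn.
Qed.

Lemma tableau_sum_branching (R : comNzRingType) (la : seq nat) (m k N : nat)
    (wt : nat -> cell la -> R) (y : nat -> nat -> R) (mu : nat -> nat) :
  (forall s, (crow s <= k)%N -> wt k s = y k (ccol s + k - crow s)%N) ->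
  (k <= m)%N -> (forall i, mu i.+1 <= mu i)%N ->
  (forall i, mu i <= nth 0%N la i)%N ->
  (forall i, k < i -> mu i = 0)%N -> (mu 0%N <= N)%N ->
  tableau_sum m wt k.+1 mu =
  \sum_(nu : {ffun 'I_k -> 'I_N.+1} |
      [forall i : 'I_k, mu i.+1 <= nu i <= mu i]%N)
    (\prod_(i < k.+1)
       \prod_(row_length nu i <= b < mu i) y k (b + k - i)%N) *
    tableau_sum m wt k (row_length nu).
Proof.
move=> wtE km mu_dec mula mu0 mu0N; rewrite /tableau_sum.
rewrite (partition_big (shape_below k N mu)
  (fun nu => [forall i : 'I_k, mu i.+1 <= nu i <= mu i]%N)) /=; last first.
  by move=> T; apply: shape_below_interlace.
apply: eq_bigr => nu munu.
(* A tableau over [nu] is recovered from its entries below [k], since the other cells of [mu] can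
   only carry [k]. *)
rewrite (reindex_onto (extend_tableau k (row_length nu) mu)
  (restrict_tableau (row_length nu))) /=; last first.
  move=> T /andP[Ttab /eqP Tnu]; apply/ffunP => s; rewrite !ffunE.
  have [Tk T0 _ _] := partial_tableauP _ _ _ Ttab.
  case: (boolP (in_shape (row_length nu) s)) => //= snu.
  case: ifP => [sm|/negbT sm]; last by rewrite T0.
  apply: val_inj; rewrite /= inordK ?ltnS //.
  move: snu; rewrite -Tnu -in_shape_below //.
  by rewrite -leqNgt => kT; apply/eqP; rewrite eqn_leq kT -ltnS Tk.
rewrite mulr_sumr; apply: eq_big => [T|T _]; first exact: extend_tableauP.
rewrite (bigID (fun s => in_shape (row_length nu) s)) /= mulrC; congr (_ * _).
  rewrite -(prod_cells (la := la) (p := k.+1) (row_length nu)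
    (fun i b => y k (b + k - i)%N)) //.
  apply: eq_big => [s|s /andP[sm snu]].
    by rewrite andbC /in_shape -leqNgt.
  rewrite ffunE sm (negPf snu) inordK // wtE // -ltnS ltnNge.
  by apply/negP => /mu0 s0; move: sm; rewrite /in_shape s0.
apply: eq_big => [s|s]; last by case/andP => _ snu; rewrite ffunE snu.
apply: andb_idl; rewrite /in_shape => /leq_trans; apply.
have [ik|ki] := ltnP (crow s) k; last by rewrite row_length_out.
rewrite (row_length_ord nu (Ordinal ik)).
by case/andP: (forallP munu (Ordinal ik)).
Qed.

(** Both sides obey the same branching recursion in [k]; for [k = 0] both are [1], from the empty
    tableau and the empty determinant. *)
Lemma tableau_sum_det (R : comNzRingType) (la : seq nat) (m k : nat)
    (wt : nat -> cell la -> R) (y : nat -> nat -> R) (mu : nat -> nat) :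
  (forall a s, (a <= m)%N -> (crow s <= a)%N ->
     wt a s = y a (ccol s + a - crow s)%N) ->
  (k <= m.+1)%N -> (forall i, mu i.+1 <= mu i)%N ->
  (forall i, mu i <= nth 0%N la i)%N -> (forall i, k <= i -> mu i = 0)%N ->
  tableau_sum m wt k mu = schur_det y k mu.
Proof.
move=> wtE; elim: k mu => [|k IHk] mu km mu_dec mula mu0.
  have mu_out s : in_shape mu s = false by rewrite /in_shape mu0.
  rewrite /schur_det det_mx00 /tableau_sum.
  rewrite (big_pred1 ([ffun=> ord0] : {ffun cell la -> 'I_m.+1})).
    by rewrite big_pred0.
  move=> T; apply/partial_tableauP/eqP => [[_ T0 _ _]|->].
    by apply/ffunP => s; rewrite ffunE T0 ?mu_out.
  by split=> [s|s|s t|s t]; rewrite ?mu_out // ffunE.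
(* One branching rule takes [nu] in ['I_N.+1], the other in ['I_N]; the bounds [mu 0] and
   [(mu 0).+1] make the two index types agree. *)
rewrite (@tableau_sum_branching _ _ _ _ (mu 0%N) _ y) //; last first.
  by move=> s; apply: wtE.
rewrite (@schur_det_branching _ y k (mu 0%N).+1) //.
apply: eq_bigr => nu /forallP munu; congr (_ * _).
have nu_mu i : (row_length nu i <= mu i)%N.
  have [ik|ki] := ltnP i k; last by rewrite row_length_out.
  by rewrite (row_length_ord nu (Ordinal ik)); case/andP: (munu (Ordinal ik)).
have mu_nu i : (mu i.+1 <= row_length nu i)%N.
  have [ik|ki] := ltnP i k; last by rewrite mu0.
  by rewrite (row_length_ord nu (Ordinal ik)); case/andP: (munu (Ordinal ik)).
apply: IHk => [|i|i|i].
- exact: ltnW.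
- exact: leq_trans (nu_mu _) (mu_nu _).
- exact: leq_trans (nu_mu _) (mula _).
- exact: row_length_out.
Qed.

(** * The geometric energy as a Krylov determinant *)

Lemma cell_rowE (la : seq nat) (s : cell la) : cell_row s = (crow s).+1.
Proof. by []. Qed.

Lemma cell_colE (la : seq nat) (s : cell la) : cell_col s = (ccol s).+1.
Proof. by []. Qed.

(** An entry [a] in row [i] and column [b], counted from zero, is read at time [s = b + a - i], and
    [r + a - s = r + i - b] is the content shifted by [r]. The tableaux fill all of [la], so no cell
    carries the dummy value. *)
Lemma loop_schur_det (R : comNzRingType) (m n : nat) (x : 'M[R]_(m.+1, n))
    (r : int) (la : seq nat) (y : nat -> nat -> R) :
  (forall (a : 'I_m.+1) s, y a s = loop_var x a (r + a%:Z - s%:Z)) ->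
  (forall i, nth 0 la i.+1 <= nth 0 la i)%N -> (size la <= m.+1)%N ->
  loop_schur x r la =
  schur_det y m.+1 (nth 0%N la).
Proof.
move=> yE la_dec la_size.
pose wt a (s : cell la) := loop_var x (inord a) (content s + r).
rewrite -(@tableau_sum_det _ la m m.+1 wt) //; first last.
- by move=> i i_ge; rewrite nth_default // (leq_trans la_size).
- move=> a s am s_a; rewrite /wt -[X in y X _](@inordK m a) // yE inordK //.
  congr loop_var.
  rewrite /content cell_rowE cell_colE; lia.
have all_in (s : cell la) : in_shape (nth 0%N la) s by apply: ccol_lt.
rewrite /loop_schur /tableau_sum; apply: eq_big => [T|T _].
  apply/forallP/partial_tableauP => [Tss|[_ _ Trow Tcol] s].
    split=> [s _|s|s t _ _ st cst|s t _ _ cst st]; first exact: ltn_ord.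
    - by rewrite all_in.
    - have /forallP/(_ t)/andP[/implyP + _] := Tss s; apply.
      by rewrite !cell_rowE !cell_colE eqSS ltnS st eqxx.
    - have /forallP/(_ t)/andP[_ /implyP +] := Tss s; apply.
      by rewrite !cell_rowE !cell_colE eqSS ltnS cst eqxx.
  apply/forallP => t; rewrite !cell_rowE !cell_colE !eqSS !ltnS.
  apply/andP; split; apply/implyP => /andP[/eqP st ?].
    exact: Trow.
  exact: Tcol.
apply: eq_big => [s|s _]; first by rewrite all_in.
by rewrite /wt inord_val.
Qed.

(** The row index cancels: the congruence says that [n + 1] divides [j + 1 + s], so [j] is [n] minus
    the residue of [s]. *)
Lemma loop_var_rev (R : comNzRingType) (m n : nat) (x : 'M[R]_(m, n.+1))
    (i : 'I_m) (s : nat) :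
  loop_var x i (n.+1%:Z + i%:Z - s%:Z) = x i (rev_ord (inord (s %% n.+1))).
Proof.
have congrE (j : 'I_n.+1) :
    (j.+1%:Z == (n.+1%:Z + i%:Z - s%:Z) - i.+1%:Z + 1 %[mod n.+1%:Z])%Z =
    (j == rev_ord (inord (s %% n.+1))).
  have s_lt : (s %% n.+1 < n.+1)%N by rewrite ltn_mod.
  rewrite eqz_mod_dvd.
  have -> : j.+1%:Z - (n.+1%:Z + i%:Z - s%:Z - i.+1%:Z + 1) =
            (j.+1 + s)%N%:Z - n.+1%:Z by lia.
  rewrite rpredBr ?dvdzz //.
  rewrite dvdzE /= {1}(divn_eq s n.+1) addnCA dvdn_addr ?dvdn_mull //.
  rewrite -val_eqE /= inordK //.
  apply/idP/eqP => [/dvdnP[q]|->].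
    have := ltn_ord j; move: s_lt; set t := (s %% n.+1)%N.
    (* As [0 < j + 1 + t < 2 (n + 1)], the quotient is [1]. *)
    case: q => [|[|q]]; [lia|lia|rewrite !mulSn; lia].
  by apply/dvdnP; exists 1%N; lia.
rewrite /loop_var; case: pickP => [j|/(_ (rev_ord (inord (s %% n.+1))))].
  by rewrite congrE => /eqP ->.
by rewrite congrE eqxx.
Qed.

(** Time runs against the order of the factors: time [s] belongs to column [n - s] of [x]. The
    induction therefore treats the product of the last [l] factors. *)
Lemma Mbar_path_sum (R : comNzRingType) (m n : nat) (x : 'M[R]_(m, n.+1))
    (y : nat -> nat -> R) :
  (forall (a : 'I_m) s, (s <= n)%N -> y a s = x a (inord (n - s))) ->
  forall a c, Mbar x a c = path_sum y n.+1 a c.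
Proof.
move=> yx; pose W j := whirl (fun i => x i (inord j)).
have prodW l : (l <= n.+1)%N -> forall a c,
    (\big[mulmx/1%:M]_(n.+1 - l <= j < n.+1) W j) a c = path_sum y l a c.
  elim: l => [|l IHl] ln a c.
    by rewrite big_geq ?subn0 // mxE.
  rewrite big_ltn ?subSS; last by lia.
  have -> : (n - l).+1 = (n.+1 - l)%N by lia.
  rewrite mxE /= (bigD1 a) //= mxE eqxx IHl ?(ltnW ln) // yx //; congr (_ + _).
  case: a => [[|a] am] /=.
    rewrite big1 // => b ba; rewrite mxE eq_sym (negPf ba) /= mul0r //.
  rewrite (bigD1 (Ordinal (ltnW am))) /=; last by rewrite -val_eqE /= ltn_eqF.
  rewrite !mxE -val_eqE /= eqxx gtn_eqF // mul1r IHl ?(ltnW ln) //=.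
  rewrite big1 ?addr0 // => b /andP[ba ba'].
  rewrite mxE eq_sym (negPf ba) /= eqSS.
  by move: ba'; rewrite -val_eqE /= eq_sym => /negPf ->; rewrite mul0r.
move=> a c; rewrite -prodW // subnn big_mkord /Mbar.
congr (fun_of_matrix _ _ _); apply: eq_bigr => j _; rewrite /W inord_val //.
Qed.

(** The product of [l + n] whirl matrices is cut after its first [l] factors, which by periodicity
    are again [W_(l-1) ... W_0]. Paths never rise, so the levels below [N] suffice. *)
Lemma path_sum_addn (R : comNzRingType) (y : nat -> nat -> R) (n N l a c : nat) :
  (forall a s, y a (s + n)%N = y a s) -> (a < N)%N ->
  path_sum y (l + n) a c = \sum_(b < N) path_sum y l a b * path_sum y n b c.
Proof.
move=> y_per; elim: l a => [|l IHl] a aN.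
  rewrite add0n (bigD1 (Ordinal aN)) //= eqxx mul1r big1 ?addr0 // => b.
  by rewrite -val_eqE /= eq_sym => /negPf ->; rewrite mul0r.
rewrite addSn /= y_per IHl // mulr_sumr.
under [RHS]eq_bigr do rewrite mulrDl -mulrA.
rewrite big_split /=; congr (_ + _); case: a aN => [|a] aN.
  by rewrite big1 // => b _; rewrite mul0r.
by rewrite IHl // ltnW.
Qed.

(** Here [u p] is [e M^p] with [e] the basis row vector of index [j + N.+1]. The bottom row is [e],
    supported in the last column, and is expanded away; after the row operation the other rows form
    a product of two square matrices. *)
Lemma det_krylov_step (R : comNzRingType) (M u : nat -> nat -> R) (j N : nat) :
  (forall a c, (a < c)%N -> M a c = 0) ->
  (forall c, u 0%N c = (j + N.+1 == c)%N%:R) ->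
  (forall p c, u p.+1 c = \sum_(b < (j + N.+1).+1) u p b * M b c) ->
  \det (\matrix_(i < N.+2, c < N.+2) u (N.+1 - i)%N (c + j)%N) =
  \det (\matrix_(a < N.+1, b < N.+1)
          (M (a + j.+1)%N (b + j)%N - (if a.+1 == b then M j j else 0))) *
  \det (\matrix_(i < N.+1, c < N.+1) u (N - i)%N (c + j.+1)%N).
Proof.
move=> M_low u0 uS.
(* The new row [i] is [u (N - i) *m (M - M j j)], to which the indices [b <= j] do
   not contribute because [M] is lower triangular. *)
rewrite (det_sub_next _ (fun i c => u (N.+1 - i)%N (c + j)%N) (fun=> M j j)).
rewrite (det_last_row (A := fun i c => u (N.+1 - i)%N (c + j)%N -
  (if (i < N.+1)%N then M j j * u (N.+1 - i.+1)%N (c + j)%N else 0))); last first.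
  move=> c cN; rewrite ltnn subr0 subnn u0; case: eqP => //; lia.
rewrite ltnn subr0 subnn u0 addnC eqxx mul1r [RHS]mulrC -det_mulmx.
congr (\det _); apply/matrixP => i c.
rewrite !mxE ltn_ord subSS subSn; last by rewrite -ltnS.
pose G b := u (N - i)%N b *
  (M b (c + j)%N - (if b == (c + j)%N then M j j else 0)).
have -> : u (N - i).+1 (c + j)%N - M j j * u (N - i)%N (c + j)%N =
    \sum_(0 <= b < (j + N.+1).+1) G b.
  rewrite big_mkord uS /G; under [RHS]eq_bigr do rewrite mulrBr.
  rewrite sumrB; congr (_ - _).
  have cj : (c + j < (j + N.+1).+1)%N by have := ltn_ord c; lia.
  rewrite (bigD1 (Ordinal cj)) //= eqxx big1 ?addr0 1?mulrC // => b.
  by rewrite -val_eqE /= => /negPf ->; rewrite mulr0.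
rewrite (big_cat_nat (n := j.+1)) //=; last by lia.
rewrite big_nat_cond big1 ?add0r; last first.
  move=> b /andP[/andP[_ bj] _]; rewrite /G.
  have [bc|bc] := eqVneq b (c + j)%N.
    have [bj' cj'] : b = j /\ (c + j)%N = j by split; lia.
    by rewrite bj' cj' subrr mulr0.
  by rewrite M_low ?subr0 ?mulr0 //; lia.
rewrite -[j.+1]add0n big_addn.
have -> : ((j + N.+1).+1 - j.+1)%N = N.+1 by lia.
rewrite big_mkord; apply: eq_bigr => a _; rewrite !mxE /G add0n.
congr (_ * (_ - _)); by have -> : (a + j.+1 == c + j)%N = (a.+1 == c)%N by lia.
Qed.

(** The minor of [M - M j j] with rows [j+1, ..., j+N] and columns [j, ..., j+N-1]; the test
    [a.+1 == b] detects the diagonal of [M]. *)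
Definition corner_det (R : comNzRingType) (M : nat -> nat -> R) (j N : nat) : R :=
  \det (\matrix_(a < N, b < N)
          (M (a + j.+1)%N (b + j)%N - (if a.+1 == b then M j j else 0))).

Lemma det_krylov (R : comNzRingType) (M u : nat -> nat -> R) (m j N : nat) :
  (forall a c, (a < c)%N -> M a c = 0) ->
  (forall c, u 0%N c = (m == c)%:R) ->
  (forall p c, u p.+1 c = \sum_(b < m.+1) u p b * M b c) ->
  (j + N = m)%N ->
  \det (\matrix_(i < N.+1, c < N.+1) u (N - i)%N (c + j)%N) =
  \prod_(j <= i < m) corner_det M i (m - i).
Proof.
move=> M_low u0 uS; elim: N j => [|N IHN] j jN.
  by rewrite det_mx11 mxE /= u0 add0n -jN addn0 eqxx big_geq.
rewrite (@det_krylov_step _ M) ?jN // IHN ?addSnnS //.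
rewrite (@big_ltn _ _ _ j) //; last by lia.
by congr (corner_det _ _ _ * _); lia.
Qed.

Lemma geometric_energy_prod (R : comNzRingType) (m n : nat)
    (x : 'M[R]_(m.+1, n.+1)) (M : nat -> nat -> R) :
  (forall a c : 'I_m.+1, M a c = Mbar x a c) ->
  geometric_energy x = \prod_(j < m) corner_det M j (m - j).
Proof.
move=> MxE.
pose y a s : R := x (inord a) (rev_ord (inord (s %% n.+1))).
(* [M] is prescribed only on indices up to [m], whereas [M'] is lower triangular at all natural
   indices. *)
pose M' a c := path_sum y n.+1 a c.
have M'E (a c : 'I_m.+1) : M' a c = Mbar x a c.
  rewrite /M' (Mbar_path_sum (y := y)) // => {}a s sn.
  rewrite /y inord_val; congr (x _ _); apply: val_inj.
  by rewrite /= !inordK ?modn_small //; lia.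
have y_per a s : y a (s + n.+1)%N = y a s by rewrite /y modnDr.
pose u p c := path_sum y (p * n.+1) m c.
have lamE i : nth 0%N (scaled_staircase n m.+1) i = (n * (m - i))%N.
  have [im|mi] := ltnP i m.
    by rewrite (nth_map 0%N) ?size_iota // nth_iota // add1n subSS.
  by rewrite nth_default ?size_map ?size_iota // (eqP mi) muln0.
rewrite /geometric_energy /= (@loop_schur_det _ _ _ _ _ _ y); first last.
- by rewrite size_map size_iota.
- by move=> i; rewrite !lamE leq_mul2l leq_sub2l ?orbT.
- by move=> a s; rewrite /y inord_val loop_var_rev.
(* Row [i] involves [n (m - i) + (m - i)] whirl matrices, that is [m - i] full periods of length
   [n.+1]. *)
transitivity (\det (\matrix_(i < m.+1, c < m.+1) u (m - i)%N (c + 0)%N)).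
  congr (\det _); apply/matrixP => i c; rewrite !mxE lamE /u addn0.
  by congr path_sum; lia.
rewrite (@det_krylov _ M' _ m) ?add0n //.
- rewrite big_mkord; apply: eq_bigr => j _; congr (\det _).
  apply/matrixP => a b; rewrite !mxE.
  have aj : (a + j.+1 < m.+1)%N by have := ltn_ord a; lia.
  have bj : (b + j < m.+1)%N by have := ltn_ord b; lia.
  have jm : (j < m.+1)%N by have := ltn_ord j; lia.
  have ME a' c' (am : (a' < m.+1)%N) (cm : (c' < m.+1)%N) : M' a' c' = M a' c'.
    by rewrite (M'E (Ordinal am) (Ordinal cm)) -MxE.
  by rewrite !ME.
- by move=> a c; apply: path_sum_gt.
- by move=> p c; rewrite /u mulSn addnC (path_sum_addn (N := m.+1)).
Qed.

(** * Expansion of the corner minors *)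

Lemma big_subset_setU1 (V : nmodType) (T : finType) (k : T) (S : {set T})
    (F : {set T} -> V) : k \notin S ->
  \sum_(X : {set T} | X \subset k |: S) F X =
  \sum_(X : {set T} | X \subset S) F X +
  \sum_(X : {set T} | X \subset S) F (k |: X).
Proof.
move=> kS; rewrite (bigID (fun X : {set T} => k \in X)) /= addrC; congr (_ + _).
  apply: eq_bigl => X; apply/andP/idP => [[XS kX]|XS].
    apply/subsetP => t tX; have := subsetP XS t tX; rewrite !inE.
    by case: eqP tX kX => //= -> ->.
  split; first exact: subset_trans XS (subsetUr _ _).
  by apply: contraNN kS; apply: subsetP.
rewrite (reindex_onto (fun X => k |: X) (fun X => X :\ k)) /=; last first.
  by move=> X /andP[_ /setD1K].
apply: eq_bigl => X; rewrite setU11 andbT; apply/andP/idP => [[kXS /eqP <-]|XS].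
  apply/subsetP => t; rewrite !inE => /andP[tk].
  rewrite (negPf tk) /= => tX; have := subsetP kXS t.
  by rewrite !inE (negPf tk) tX; apply.
split; first exact: setUS.
by rewrite setU1K //; apply: contraNN kS; apply: subsetP.
Qed.

(** Deleting [k] amounts to skipping position [size s1], which is how a cofactor indexes its rows
    and columns. *)
Lemma nth_bump (T : Type) (d : T) (s1 s2 : seq T) (k : T) (i : nat) :
  nth d (s1 ++ k :: s2) (bump (size s1) i) = nth d (s1 ++ s2) i.
Proof.
rewrite !nth_cat /bump; case: (leqP (size s1) i) => [s1i|is1] /=.
  by rewrite ?add1n ltnNge (leqW s1i) /= subSn // ltnNge s1i.
by rewrite ?add0n is1.
Qed.

Definition seq_minor (R : comNzRingType) (m N : nat) (A : 'M[R]_m.+1)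
    (rows cols : seq 'I_m.+1) : R :=
  \det (\matrix_(a < N, b < N) A (nth ord0 rows a) (nth ord0 cols b)).

(** [L] lists the diagonal positions still to be expanded; it shrinks until [A] itself is left. *)
Definition sub_diag (R : comNzRingType) (m : nat) (A : 'M[R]_m.+1) (c : R)
    (L : seq 'I_m.+1) : 'M[R]_m.+1 :=
  \matrix_(i, j) (A i j - (if (i == j) && (i \in L) then c else 0)).

(* The diagonal position of [k] sits in row [size P] and column [(size P).+1] of
   the minor, so its cofactor has sign [-1], which cancels that of [- c]. *)
Lemma seq_minor_cons (R : comNzRingType) (m N : nat) (A : 'M[R]_m.+1) (c : R)
    (e j k : 'I_m.+1) (P L : seq 'I_m.+1) :
  uniq (j :: P ++ k :: L) -> uniq (P ++ k :: L ++ [:: e]) ->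
  N = (size P + size L).+1 ->
  seq_minor N.+1 (sub_diag A c (k :: L))
    (P ++ k :: L ++ [:: e]) (j :: P ++ k :: L) =
  seq_minor N.+1 (sub_diag A c L) (P ++ k :: L ++ [:: e]) (j :: P ++ k :: L) +
  c * seq_minor N (sub_diag A c L) (P ++ L ++ [:: e]) (j :: P ++ L).
Proof.
move=> jPkL PkLe NE; set rows := P ++ _; set cols := j :: _.
have i0N : (size P < N.+1)%N by lia.
have i1N : ((size P).+1 < N.+1)%N by lia.
pose i0 := Ordinal i0N; pose i1 := Ordinal i1N.
have rowsi0 : nth ord0 rows i0 = k by rewrite nth_cat ltnn subnn.
have colsi1 : nth ord0 cols i1 = k by rewrite /= nth_cat ltnn subnn.
have size_rows : size rows = N.+1 by rewrite /rows !size_cat /= size_cat /=; lia.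
have size_cols : size cols = N.+1 by rewrite /= size_cat /=; lia.
have rows_k (a : 'I_N.+1) : (nth ord0 rows a == k) = (a == i0).
  by rewrite -{1}rowsi0 nth_uniq ?size_rows.
have cols_k (b : 'I_N.+1) : (nth ord0 cols b == k) = (b == i1).
  by rewrite -{1}colsi1 nth_uniq ?size_cols.
(* Row [i0] of the minor is its row for [sub_diag A c L] minus [c] times the basis vector of [i1];
   [C] has that basis vector in row [i0]. *)
pose C := \matrix_(a < N.+1, b < N.+1) if a == i0 then (b == i1)%:R else
  sub_diag A c L (nth ord0 rows a) (nth ord0 cols b).
rewrite /seq_minor (@determinant_multilinear _ _ _
  (\matrix_(a, b) sub_diag A c L (nth ord0 rows a) (nth ord0 cols b))
  C i0 1 (- c)).
- rewrite mul1r mulNr -mulrN; congr (_ + c * _).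
  rewrite (expand_det_row _ i0) (bigD1 i1) //= big1 ?addr0; last first.
    by move=> b /negPf bi1; rewrite mxE eqxx bi1 mul0r.
  rewrite mxE !eqxx mul1r /cofactor /= addnS addnn -signr_odd /= odd_double expr1.
  rewrite mulN1r opprK; congr (\det _); apply/matrixP => a b.
  rewrite !mxE eq_sym (negPf (neq_lift _ _)) /=.
  by rewrite nth_bump -cat_cons; have /= -> := nth_bump ord0 (j :: P) L k b.
- apply/rowP => b; rewrite !mxE eqxx rowsi0 mul1r mulNr.
  have kL : k \notin L.
    by move: jPkL; rewrite cons_uniq cat_uniq => /and4P[_ _ _ /andP[]].
  rewrite mem_head (negPf kL) !andbF andbT subr0 -(cols_k b) [_ == k]eq_sym.
  by case: eqP; rewrite ?mulr1 ?mulr0.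
- apply/matrixP => a b; rewrite !mxE inE.
  have := neq_lift i0 a; rewrite eq_sym => /negPf.
  by rewrite -rows_k => ->.
- apply/matrixP => a b; rewrite !mxE inE.
  have := neq_lift i0 a; rewrite eq_sym => /negPf ai.
  by rewrite ai rows_k ai.
Qed.

(** Induction on [L]: each [k] in [L] is either deleted, giving a factor [c], or kept, and then it
    joins [P]. The set [X] collects the kept indices. *)
Lemma seq_minor_expand (R : comNzRingType) (m : nat) (A : 'M[R]_m.+1) (c : R)
    (e j : 'I_m.+1) (P L : seq 'I_m.+1) :
  uniq (j :: P ++ L) -> uniq (P ++ L ++ [:: e]) ->
  seq_minor (size P + size L).+1 (sub_diag A c L)
    (P ++ L ++ [:: e]) (j :: P ++ L) =
  \sum_(X : {set 'I_m.+1} | X \subset [set i in L])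
    c ^+ (size L - #|X|) *
    seq_minor (size P + #|X|).+1 A
      (P ++ [seq i <- L | i \in X] ++ [:: e]) (j :: P ++ [seq i <- L | i \in X]).
Proof.
elim: L P => [|k L IHL] P jPL PLe.
  have -> : sub_diag A c [::] = A.
    by apply/matrixP => a b; rewrite !mxE in_nil andbF subr0.
  rewrite (big_pred1 set0) /= ?cards0 ?mul1r //.
  by move=> X; rewrite /= -subset0; congr (X \subset _).
have kL : k \notin L.
  by move: jPL; rewrite cons_uniq cat_uniq => /and4P[_ _ _ /andP[]].
have kLE : [set i in k :: L] = k |: [set i in L].
  by apply/setP => i; rewrite !inE.
have card_le (X : {set _}) : X \subset [set i in L] -> (#|X| <= size L)%N.
  move=> XL; apply: leq_trans (subset_leq_card XL) _.
  by rewrite cardsE; apply: card_size.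
rewrite seq_minor_cons //=; last by rewrite addnS.
rewrite kLE big_subset_setU1 ?inE // addrC; congr (_ + _).
  rewrite addnS IHL; first last.
  - by apply: subseq_uniq PLe; rewrite cat_subseq // subseq_cons.
  - apply: subseq_uniq jPL; rewrite -!cat_cons.
    by rewrite cat_subseq // subseq_cons.
  rewrite mulr_sumr; apply: eq_bigr => X XL.
  have kX : k \notin X by apply: contraNN kL => /(subsetP XL); rewrite inE.
  by rewrite (negPf kX) subSn ?card_le // exprS mulrA.
have := IHL (rcons P k); rewrite !cat_rcons size_rcons addSnnS => -> //.
apply: eq_bigr => X XL.
have kX : k \notin X by apply: contraNN kL => /(subsetP XL); rewrite inE.
rewrite cardsU1 kX add1n subSS setU11 addSnnS !cat_rcons.
have -> // : [seq i <- L | i \in k |: X] = [seq i <- L | i \in X].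
apply: eq_in_filter => i iL; rewrite !inE; case: eqP => // ik.
by rewrite -ik iL in kL.
Qed.

Lemma ltn_val_trans (n : nat) : transitive (relpre (@nat_of_ord n) ltn).
Proof. by move=> b a c; apply: ltn_trans. Qed.

Lemma sorted_enum_ord (n : nat) (A : {pred 'I_n}) :
  sorted (relpre (@nat_of_ord n) ltn) (enum A).
Proof.
rewrite /enum_mem -enumT; apply: sorted_filter; first exact: ltn_val_trans.
by rewrite -sorted_map val_enum_ord iota_ltn_sorted.
Qed.

Lemma enum_ord_sorted (n : nat) (A : {set 'I_n}) (s : seq 'I_n) :
  sorted (relpre (@nat_of_ord n) ltn) s -> s =i A -> enum A = s.
Proof.
move=> s_sorted sA; apply: irr_sorted_eq (sorted_enum_ord A) s_sorted _.
- exact: ltn_val_trans.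
- by move=> a; apply: ltnn.
by move=> i; rewrite mem_enum sA.
Qed.

Lemma minor_seq_minor (R : comNzRingType) (m : nat) (A B : {set 'I_m.+1})
    (M : 'M[R]_m.+1) :
  #|A| = #|B| -> minor A B M = seq_minor #|A| M (enum A) (enum B).
Proof.
rewrite /minor; case: eqP => // eqAB _; congr (\det _).
by apply/matrixP => a b; rewrite !mxE !(enum_val_nth ord0).
Qed.

(** With [L] the indices strictly between [j] and [m], the corner has rows [L, m] and columns
    [j, L]. The diagonal of [A] meets it exactly at [L], so the expansion applies with [P] empty and
    [c = A j j]. *)
Lemma corner_det_minors (R : comNzRingType) (m : nat) (A : 'M[R]_m.+1)
    (M : nat -> nat -> R) (j : 'I_m.+1) :
  (forall a c : 'I_m.+1, M a c = A a c) -> (j < m)%N ->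
  corner_det M j (m - j) =
  \sum_(X : {set 'I_m.+1} |
      X \subset [set k : 'I_m.+1 | (j.+2 <= k.+1 <= m)%N])
    A j j ^+ (m - j.+1 - #|X|) *
    minor (X :|: [set k : 'I_m.+1 | k.+1 == m.+1]) (j |: X) A.
Proof.
move=> MA jm; pose L := [seq k : 'I_m.+1 <- enum 'I_m.+1 | (j < k < m)%N].
have L_sorted : sorted (relpre (@nat_of_ord m.+1) ltn) L.
  exact: sorted_filter (@ltn_val_trans _) _ _ (sorted_enum_ord _).
have memL k : (k \in L) = (j < k < m)%N by rewrite mem_filter mem_enum andbT.
have valL : map val L = iota j.+1 (m - j.+1).
  apply: (irr_sorted_eq ltn_trans ltnn); last 1 first.
  - move=> k; rewrite mem_iota subnKC //; apply/mapP/idP => [|kjm].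
      by case=> i iL ->; rewrite -memL.
    have km : (k < m.+1)%N by lia.
    by exists (Ordinal km); rewrite ?memL.
  - by rewrite sorted_map.
  - exact: iota_ltn_sorted.
have sizeL : size L = (m - j.+1)%N by rewrite -(size_map val) valL size_iota.
have uniqL : uniq L by rewrite filter_uniq ?enum_uniq.
have S_L : [set k : 'I_m.+1 | (j.+2 <= k.+1 <= m)%N] = [set k in L].
  by apply/setP => k; rewrite !inE memL.
have lastE : [set k : 'I_m.+1 | k.+1 == m.+1] = [set ord_max].
  by apply/setP => k; rewrite !inE eqSS.
have uniq_rows : uniq (L ++ [:: ord_max]).
  by rewrite cats1 rcons_uniq uniqL memL ltnn andbF.
have uniq_cols : uniq (j :: L) by rewrite /= uniqL memL ltnn.
have := seq_minor_expand A (A j j) (P := [::]) uniq_cols uniq_rows.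
rewrite S_L -sizeL => /= expand.
transitivity (seq_minor (size L).+1 (sub_diag A (A j j) L)
                (L ++ [:: ord_max]) (j :: L)).
  rewrite /corner_det /seq_minor sizeL subnSK //; congr (\det _).
  apply/matrixP => a b; rewrite !mxE.
  have val_nth (s : seq (ordinal m.+1)) k : (k < size s)%N ->
      nth ord0 s k = nth 0%N (map val s) k :> nat.
    by move=> ks; rewrite (nth_map ord0).
  have rowE : nth ord0 (L ++ [:: ord_max]) a = (a + j.+1)%N :> nat.
    rewrite val_nth ?size_cat ?sizeL ?addn1 ?subnSK //.
    rewrite map_cat valL /= nth_cat size_iota; case: ltnP => am.
      by rewrite nth_iota // addnC.
    have := ltn_ord a => aN; have -> : (a - (m - j.+1))%N = 0%N by lia.
    rewrite /=; lia.
  have colE : nth ord0 (j :: L) b = (b + j)%N :> nat.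
    rewrite val_nth /= ?sizeL ?subnSK // valL -/(iota j (m - j.+1).+1).
    by rewrite nth_iota ?subnSK // addnC.
  rewrite -rowE -colE !MA; congr (_ - _).
  rewrite memL -val_eqE [val _]rowE [val _]colE rowE.
  have -> : (a + j.+1 == b + j)%N = (a.+1 == b)%N by lia.
  (* If [a.+1 = b], then [b < m - j] gives [a + j.+1 < m], so this row index is in [L]. *)
  by case: eqP => //= ab; rewrite ifT //; have := ltn_ord b; lia.
rewrite [LHS]expand; apply: eq_bigr => X XL; congr (_ * _).
have X_L i : i \in X -> i \in L by move=> /(subsetP XL); rewrite inE.
have jX : j \notin X by apply/negP => /X_L; rewrite memL ltnn.
have maxX : ord_max \notin X by apply/negP => /X_L; rewrite memL ltnn andbF.
have F_sorted : sorted (relpre (@nat_of_ord m.+1) ltn) [seq i <- L | i \in X].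
  exact: sorted_filter (@ltn_val_trans _) _ _ L_sorted.
have memF i : (i \in [seq i <- L | i \in X]) = (i \in X).
  by rewrite mem_filter; apply: andb_idr; apply: X_L.
rewrite lastE setUC minor_seq_minor ?cardsU1 ?maxX ?jX //.
(* All of [X] lies strictly between [j] and [m], so putting [m] last and [j] first yields the
   increasing enumerations. *)
rewrite add0n add1n; congr seq_minor; apply/esym/enum_ord_sorted.
- rewrite (sorted_pairwise (@ltn_val_trans _)) pairwise_cat /= andbT.
  rewrite -(sorted_pairwise (@ltn_val_trans _)) F_sorted andbT.
  apply/allrelP => i k; rewrite memF inE => /X_L + /eqP ->.
  by rewrite memL => /andP[].
- by move=> i; rewrite mem_cat memF !inE orbC.
- rewrite /= path_sortedE; last exact: ltn_val_trans.
  rewrite F_sorted andbT; apply/allP => i.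
  by rewrite memF => /X_L; rewrite memL => /andP[].
- by move=> i; rewrite !inE memF.
Qed.

Theorem theorem7p10 (R : realType) (m n : nat) (m_gt0 : (0 < m)%N)
    (n_gt0 : (0 < n)%N) :
  let x : 'M[{mpoly (complex R)[m * n]}]_(m, n) :=
    \matrix_(i < m, j < n) 'X_(mxvec_index i j) in
  geometric_energy x =
  \prod_(j < m | (j.+1 <= m.-1)%N)
    \sum_(X : {set 'I_m} | X \subset [set k : 'I_m | (j.+2 <= k.+1 <= m.-1)%N])
      Mbar x j j ^+ (m.-1 - j.+1 - #|X|) *
      minor (X :|: [set k : 'I_m | k.+1 == m]) (j |: X) (Mbar x).
Proof.
move=> x; move: x; case: m m_gt0 => // m _; case: n n_gt0 => // n _ x.
pose M a c := Mbar x (inord a) (inord c).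
have ME (a c : 'I_m.+1) : M a c = Mbar x a c by rewrite /M !inord_val.
rewrite (geometric_energy_prod ME) /=.
(* Here [j] must index the whole matrix, so the product moves from ['I_m] to ['I_m.+1] with the
   condition [j < m]. *)
rewrite (big_ord_widen m.+1 (fun j => corner_det M j (m - j))) //.
by apply: eq_bigr => j jm; apply: corner_det_minors ME jm.
Qed.
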